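(* Let $\theta\in\mathbb{R}\setminus\mathbb{Q}$, let $T_\theta$ be the rotation $T_\theta x=x+\theta$ on the circle $\mathbb{T}=\mathbb{R}/\mathbb{Z}$, and let $\eta=\eta(\theta)$ be the irrationality exponent of $\theta$. For $n\in\mathbb{N}$ and $(x,y)\in\mathbb{T}^2$, let $m_n(x,y)$ be the shortest distance between the orbits of $x$ and $y$ under $T_\theta$. Then for Lebesgue almost all $(x,y)\in\mathbb{T}^2$, $$\liminf_{n\to\infty}\frac{\log m_n(x,y)}{-\log n}=\frac{1}{\eta}\qquad\text{and}\qquad\limsup_{n\to\infty}\frac{\log m_n(x,y)}{-\log n}=1.$$
   Context: For a real number (or element of $\mathbb{T}$) $t$, $\|t\|$ denotes the distance from $t$ to the nearest integer; the distance on $\mathbb{T}$ is $d(x,y)=\|x-y\|$. The shortest distance between the orbits is $$m_n(x,y)=\min_{i,j=0,\dots,n-1}d(T_\theta^ix,T_\theta^jy)=\min_{-(n-1)\le j\le n-1}\|(x-y)+j\theta\|.$$ The irrationality exponent of $\theta$ is $$\eta(\theta)=\sup\{\beta\ge1:\liminf_{j\to\infty}j^\beta\|j\theta\|=0\},$$ with the conventions that $\eta=1$ if this set is empty and $1/\eta=0$ if $\eta=+\infty$. *)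

(* Defs.v *)
From HB Require Import structures.
From mathcomp Require Import all_boot all_order all_algebra.
From mathcomp Require Import all_classical all_reals all_analysis.

Set Implicit Arguments.
Unset Strict Implicit.
Unset Printing Implicit Defensive.

Import Order.TTheory GRing.Theory Num.Theory.
Import numFieldNormedType.Exports.

Local Open Scope classical_set_scope.
Local Open Scope ring_scope.

Definition dist_int (R : realType) (t : R) : R :=
  inf [set `|t - k%:~R| | k in [set: int]].

(* The circle R/Z is represented by its fundamental domain [0, 1[: a point of
   the circle is its unique representative in [0, 1[, and the Lebesgue measure
   of the circle is that of R restricted to [0, 1[. *)
Definition circle (R : realType) : set R := `[0, 1[.
Arguments circle R : clear implicits.

Definition mod1 (R : realType) (t : R) : R := t - (Num.floor t)%:~R.

Definition rotation (R : realType) (theta x : R) : R := mod1 (x + theta).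

(* Only the classes of x and y modulo 1 matter. *)
Definition circle_dist (R : realType) (x y : R) : R := dist_int (x - y).

(* The default value circle_dist x y of the minima is the term i = j = 0, so
   for 0 < n this is exactly the minimum over 0 <= i, j < n. *)
Definition orbit_dist (R : realType) (theta : R) (n : nat) (x y : R) : R :=
  \big[Num.min/circle_dist x y]_(i < n)
    \big[Num.min/circle_dist x y]_(j < n)
      circle_dist (iter i (rotation theta) x) (iter j (rotation theta) y).

Definition approx_exponents (R : realType) (theta : R) : set R :=
  [set beta | 1 <= beta /\
     limn_einf (fun j : nat =>
       (j%:R `^ beta * dist_int (j%:R * theta))%:E) = 0%:E].

Definition irrationality_exponent (R : realType) (theta : R) : \bar R :=
  if `[< approx_exponents theta = set0 >] then 1%E
  else ereal_sup [set beta%:E | beta in approx_exponents theta].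

(* lne sends 0 to -oo, so the ratio is +oo when the two orbits meet (and
   1 < n); the values at n = 0, 1 do not affect limits. *)
Definition log_ratio (R : realType) (theta x y : R) (n : nat) : \bar R :=
  (lne (orbit_dist theta n x y)%:E / (- ln n%:R)%:E)%E.

(* Main.v *)
Require Import Defs.
From HB Require Import structures.
From mathcomp Require Import all_boot all_order all_algebra.
From mathcomp Require Import all_classical all_reals all_analysis.
From mathcomp Require Import measurable_realfun.
From mathcomp Require Import ring lra zify.
Set Implicit Arguments.
Unset Strict Implicit.
Unset Printing Implicit Defensive.

Import Order.TTheory GRing.Theory Num.Theory.
Import numFieldNormedType.Exports.
Local Open Scope classical_set_scope.
Local Open Scope ring_scope.

(** Put s = x - y and write || t || for [dist_int t].  The two orbits come as
    close as m_n = min { || s + j theta || : |j| < n }, so everything depends on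
    how well the points j theta fill the circle.

    Lower bounds on the ratio, valid for every (x, y).  Dirichlet's theorem
    gives, for each N, coprime q <= N and p with |q theta - p| < 1/N.  Since
    theta is then within 1/(qN) of p/q, the points j theta with 0 <= j < q
    shadow the grid Z/q, so m_q <= 2/q ([orbit_covering]).  As N grows, q goes
    to infinity because theta is irrational, and the limsup is at least 1.
    If moreover c <= q^b || q theta ||, as holds for all large q when
    b > eta, then c N < q^b, whence m_N <= m_q <= 2/q <= C N^(-1/b): the liminf
    is at least 1/b ([orbit_dist_le_eventually]).

    Upper bounds on the ratio, valid almost everywhere.  The set of pairs with
    || x - y + c || < r has measure at most 6r ([measure_strip_le]), so
    m_n < n^(-a) has measure O(n^(1-a)).  For a > 1 this is summable along
    n = 2^k, and Borel-Cantelli gives limsup <= 1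
    ([orbit_dist_ge_eventually]).  For the liminf, when
    || q theta || < q^(-b) with q large, the points j theta with |j| < n
    accumulate near the q points of Z/q: the set m_n < n^(-a) is covered by q
    strips of half-width n^(-a) + n q^(-1-b), of total measure
    O(q n^(-a) + n q^(-b)).  If 1/a < b and n is about q^g with 1/a < g < b,
    this tends to 0, so almost no pair satisfies m_n < n^(-a) for all large n
    ([orbit_dist_ge_infinitely_often]).  Such b exist for every a in
    (1/eta, 1], and for a > 1 the bound liminf <= limsup <= 1 is enough. *)

(** * Distance to the nearest integer and distance between orbits *)

Lemma dist_int_le (R : realType) (t : R) (k : int) :
  dist_int t <= `|t - k%:~R|.
Proof. by apply: ge_inf; [exists 0 => _ [m _ <-] | exists k]. Qed.

Lemma le_dist_int (R : realType) (t r : R) :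
  (forall k : int, r <= `|t - k%:~R|) -> r <= dist_int t.
Proof.
move=> h; apply: lb_le_inf; first by exists `|t - 0%:~R|; exists 0.
by move=> _ [k _ <-].
Qed.

Lemma dist_int_ltP (R : realType) (t r : R) :
  dist_int t < r <-> exists k : int, `|t - k%:~R| < r.
Proof.
split=> [|[k]]; last exact/le_lt_trans/dist_int_le.
move=> tr; apply: contrapT => /forallNP h.
move: tr; apply/negP; rewrite -leNgt; apply: le_dist_int => k.
by rewrite leNgt; apply/negP.
Qed.

Lemma dist_int_ge0 (R : realType) (t : R) : 0 <= dist_int t.
Proof. exact: le_dist_int. Qed.

Lemma dist_int_le1 (R : realType) (t : R) : dist_int t <= 1.
Proof.
apply: le_trans (dist_int_le _ (Num.floor t)) _.
have /andP[h1 h2] := floor_itv t.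
by rewrite ger0_norm; rewrite intrD in h2; lra.
Qed.

Lemma dist_intDz (R : realType) (t : R) (k : int) :
  dist_int (t + k%:~R) = dist_int t.
Proof.
have shift_le (u : R) (m : int) : dist_int (u + m%:~R) <= dist_int u.
  apply: le_dist_int => l.
  have := dist_int_le (u + m%:~R) (l + m).
  by rewrite intrD opprD addrACA subrr addr0.
apply/eqP; rewrite eq_le shift_le /=.
by have := shift_le (t + k%:~R) (- k); rewrite mulrNz addrK.
Qed.

(** Reducing modulo 1 at each step only adds up to one integer, which
    [dist_int] does not see. *)
Lemma iter_rotation (R : realType) (theta x : R) (i : nat) :
  exists k : int, iter i (rotation theta) x = x + i%:R * theta + k%:~R.
Proof.
elim: i => [|i [k IH]]; first by exists 0; rewrite mul0r !addr0.
exists (k - Num.floor (iter i (rotation theta) x + theta)).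
rewrite iterS /rotation /mod1 {1}IH intrD mulrNz -natr1; ring.
Qed.

Lemma circle_dist_orbits (R : realType) (theta x y : R) (i j : nat) :
  circle_dist (iter i (rotation theta) x) (iter j (rotation theta) y) =
  dist_int (x - y + (i%:R - j%:R) * theta).
Proof.
have [k ->] := iter_rotation theta x i; have [l ->] := iter_rotation theta y j.
rewrite /circle_dist -[RHS](dist_intDz _ (k - l)) intrD mulrNz.
by congr (dist_int _); ring.
Qed.

Lemma orbit_dist_le (R : realType) (theta x y : R) (n i j : nat) :
  (i < n)%N -> (j < n)%N ->
  orbit_dist theta n x y <= dist_int (x - y + (i%:R - j%:R) * theta).
Proof.
move=> ni nj; rewrite -circle_dist_orbits.
apply: (bigmin_inf (Ordinal ni)) => //.
exact: (bigmin_inf (Ordinal nj)).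
Qed.

Lemma orbit_dist_ltP (R : realType) (theta x y r : R) (n : nat) : (0 < n)%N ->
  orbit_dist theta n x y < r <->
  exists2 ij : nat * nat, (ij.1 < n)%N && (ij.2 < n)%N &
    dist_int (x - y + (ij.1%:R - ij.2%:R) * theta) < r.
Proof.
move=> n0; split; last first.
  by move=> [[i j] /= /andP[ni nj]]; apply/le_lt_trans/orbit_dist_le.
have d0 : circle_dist x y < r ->
  exists2 ij : nat * nat, (ij.1 < n)%N && (ij.2 < n)%N &
    dist_int (x - y + (ij.1%:R - ij.2%:R) * theta) < r.
  by move=> h; exists (0, 0)%N; rewrite /= ?n0 // subrr mul0r addr0.
move=> /bigmin_ltP[//|[i _ /bigmin_ltP[//|[j _]]]].
by rewrite circle_dist_orbits => h; exists (val i, val j) => //=; rewrite !ltn_ord.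
Qed.

Lemma orbit_dist_anti (R : realType) (theta x y : R) (n m : nat) :
  (0 < n)%N -> (n <= m)%N ->
  orbit_dist theta m x y <= orbit_dist theta n x y.
Proof.
move=> n0 nm; rewrite leNgt; apply/negP => /(orbit_dist_ltP _ _ _ _ n0).
move=> [[i j] /= /andP[ni nj]]; apply/negP; rewrite -leNgt.
by apply: orbit_dist_le; [exact: leq_trans ni nm|exact: leq_trans nj nm].
Qed.

Lemma orbit_dist_le1 (R : realType) (theta x y : R) (n : nat) :
  (0 < n)%N -> orbit_dist theta n x y <= 1.
Proof.
by move=> n0; exact: le_trans (orbit_dist_le _ _ _ n0 n0) (dist_int_le1 _).
Qed.

(** Only the difference i - j of the two times matters.  It is written as m - n
    with a natural number m < 2 n, which leaves 2 n candidates instead of the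
    n^2 pairs (i, j): the measure estimates below depend on this. *)
Lemma orbit_dist_lt_shift (R : realType) (theta x y r : R) (n : nat) :
  (0 < n)%N -> orbit_dist theta n x y < r ->
  exists2 m : nat, (m < 2 * n)%N &
    dist_int (x - y + (m%:R - n%:R) * theta) < r.
Proof.
move=> n0 /(orbit_dist_ltP _ _ _ _ n0)[[i j] /= /andP[ni nj] h].
exists (i + (n - j))%N; first by lia.
have -> : (i + (n - j))%:R - n%:R = i%:R - j%:R :> R.
  by rewrite natrD natrB; [ring|exact: ltnW].
exact: h.
Qed.

(** * Rational approximation and the covering of the circle by an orbit *)

(** Pigeonhole: two of the N + 1 fractional parts of i theta, 0 <= i <= N, fall
    into the same of the N boxes of length 1/N. *)
Lemma dirichlet_approximation (R : realType) (theta : R) (N : nat) : (0 < N)%N ->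
  exists q : nat, exists p : int,
    (0 < q <= N)%N /\ `|q%:R * theta - p%:~R| < N%:R^-1.
Proof.
move=> N0; have NR0 : (0 : R) < N%:R by rewrite ltr0n.
pose fl (i : nat) := Num.floor (i%:R * theta).
pose fr (i : nat) := i%:R * theta - (fl i)%:~R.
have fr_itv i : 0 <= fr i < 1.
  by have /andP[] := floor_itv (i%:R * theta); rewrite intrD /fr /fl => h1 h2; lra.
pose box (i : nat) := `|Num.floor (N%:R * fr i)|%N.
have boxE i : (box i)%:R <= N%:R * fr i < (box i)%:R + 1.
  have /andP[f0 f1] := fr_itv i.
  have fl0 : 0 <= Num.floor (N%:R * fr i) by rewrite floor_ge0 mulr_ge0// ltW.
  have := floor_itv (N%:R * fr i); rewrite intrD.
  by rewrite /box -[(`|_|%N)%:R]/((`|_|%N)%:Z%:~R) gez0_abs.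
have boxN i : (box i < N)%N.
  have /andP[f0 f1] := fr_itv i; have /andP[b1 _] := boxE i.
  rewrite -(ltr_nat R); apply: le_lt_trans b1 _.
  by rewrite gtr_pMr.
have [i [j [ij jN bij]]] : exists i j, [/\ (i < j)%N, (j <= N)%N & box i = box j].
  apply: contrapT => /forallNP h.
  pose f (i : 'I_N.+1) : 'I_N := Ordinal (boxN i).
  have finj : injective f.
    move=> i j /(congr1 val) /= bij; apply: val_inj => /=.
    have [iltj|jlti|//] := ltngtP i j; exfalso.
    - by apply: (h i); exists j; split => //; rewrite -ltnS.
    - by apply: (h j); exists i; split => //; rewrite -ltnS.
  by have := leq_card f finj; rewrite !card_ord ltnn.
exists (j - i)%N, (fl j - fl i); split; first by lia.
have /andP[i1 i2] := boxE i; have /andP[j1 j2] := boxE j; rewrite bij in i1 i2.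
have -> : (j - i)%:R * theta - (fl j - fl i)%:~R = fr j - fr i.
  by rewrite natrB ?(ltnW ij)// intrD mulrNz /fr; ring.
rewrite -(ltr_pM2l NR0) divff ?gt_eqF// -[X in X * _]gtr0_norm// -normrM.
rewrite ltr_norml mulrBr; lra.
Qed.

(** Dividing q and p by their gcd only decreases |q theta - p|. *)
Lemma dirichlet_coprime (R : realType) (theta : R) (N : nat) : (0 < N)%N ->
  exists q : nat, exists p : int, [/\ (0 < q <= N)%N, coprime q `|p|%N &
    `|q%:R * theta - p%:~R| < N%:R^-1].
Proof.
move=> N0; have [q [p [/andP[q0 qN] h]]] := dirichlet_approximation theta N0.
pose g := gcdn q `|p|%N; have g0 : (0 < g)%N by rewrite gcdn_gt0 q0.
have /dvdnP[q' q'E] : (g %| q)%N by exact: dvdn_gcdl.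
have /dvdzP[p' p'E] : (g%:Z %| p)%Z by rewrite dvdzE /=; exact: dvdn_gcdr.
exists q', p'; split.
- by move: q0 qN; rewrite q'E muln_gt0 => /andP[-> _] /=; apply/leq_trans/leq_pmulr.
- have : (g * gcdn q' `|p'| = g)%N.
    have pE : (`|p| = g * `|p'|)%N by rewrite {1}p'E abszM mulnC.
    by rewrite muln_gcdr -pE mulnC -q'E.
  by move=> /eqP; rewrite -[X in _ == X]muln1 eqn_pmul2l.
- apply: le_lt_trans h; rewrite {1}q'E p'E natrM intrM.
  rewrite -[X in _ <= `| _ - _ * X|]/(g%:R).
  have -> : q'%:R * g%:R * theta - p'%:~R * g%:R =
      g%:R * (q'%:R * theta - p'%:~R) :> R.
    by ring.
  by rewrite normrM normr_nat ler_peMl // ler1n.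
Qed.

(** For j < q the point j theta is within j |theta - p/q| <= 1/q of j p/q, and
    j p/q runs through all classes of Z/q modulo 1 because p is invertible
    modulo q; finally - s is within 1/q of some point of Z/q. *)
Lemma orbit_covering (R : realType) (theta s : R) (q : nat) (p : int) :
  (0 < q)%N -> coprime q `|p|%N -> `|q%:R * theta - p%:~R| <= q%:R^-1 ->
  exists2 j : nat, (j < q)%N & dist_int (s + j%:R * theta) <= 2 / q%:R.
Proof.
move=> q0 cqp h; have qR0 : (0 : R) < q%:R by rewrite ltr0n.
(* m/q is the point of the grid just below - s. *)
pose m := Num.floor (- s * q%:R).
have /andP[m1 m2] := floor_itv (- s * q%:R); rewrite -/m intrD in m1 m2.
have [u [v uv]] : exists u v : int, u * p + v * q = 1.
  have /coprimezP[[u v] /= uv] : coprimez p q.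
    by rewrite /coprimez /gcdz /= gcdnC (eqP cqp).
  by exists u, v.
pose j := (m * u %% q)%Z.
have j0 : 0 <= j by apply: modz_ge0; lia.
have jq : j < q by apply: ltz_pmod; lia.
(* j p/q is congruent to m/q modulo 1: u inverts p modulo q. *)
have [k jE] : exists k : int, j * p = m + k * q.
  exists (- m * v - (m * u %/ q)%Z * p).
  have := divz_eq (m * u) q; rewrite -/j => E.
  have -> : j = m * u - (m * u %/ q)%Z * q by rewrite [X in X - _]E; ring.
  rewrite -[X in _ = X + _]mulr1 -uv; ring.
exists `|j|%N; first by lia.
apply: le_trans (dist_int_le _ k) _.
have -> : (`|j|%N)%:R = j%:~R :> R by rewrite -[LHS]/(`|j|%N%:Z%:~R) gez0_abs.
have jER : j%:~R * p%:~R = m%:~R + k%:~R * q%:R :> R.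
  by rewrite -intrM jE intrD intrM.
have jqR : j%:~R / q%:R <= 1 :> R.
  by rewrite ler_pdivrMr// mul1r -[q%:R]/(q%:~R) ler_int ltW.
have -> : s + j%:~R * theta - k%:~R =
    - ((- s * q%:R) - m%:~R) / q%:R + j%:~R / q%:R * (q%:R * theta - p%:~R).
  have qR_neq0 : q%:R != 0 :> R by rewrite gt_eqF.
  have -> : k%:~R = (j%:~R * p%:~R - m%:~R) / q%:R :> R.
    by rewrite jER addrAC subrr add0r mulfK.
  by field.
apply: le_trans (ler_normD _ _) _.
rewrite [2]/(1 + 1) mulrDl !mul1r; apply: lerD.
  rewrite normrM normfV [`|q%:R|]gtr0_norm// -[leRHS]mul1r ler_pM2r ?invr_gt0//.
  by rewrite normrN ger0_norm; lra.
rewrite normrM; apply: le_trans h.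
by rewrite ler_piMl// ger0_norm// divr_ge0// ?ler0z// ltW.
Qed.

Lemma dist_int_gt0 (R : realType) (t : R) :
  (forall k : int, t != k%:~R) -> 0 < dist_int t.
Proof.
move=> tZ; pose f := Num.floor t.
have /andP[f1 f2] := floor_itv t; rewrite -/f intrD in f1 f2.
have f1' : f%:~R < t by rewrite lt_neqAle f1 eq_sym tZ.
apply: (@lt_le_trans _ _ (Num.min (t - f%:~R) (f%:~R + 1 - t))).
  by rewrite lt_min; apply/andP; split; lra.
apply: le_dist_int => k; rewrite ge_min; apply/orP.
have [kf|fk] := leP k f; [left|right].
  have kfR : (k%:~R : R) <= f%:~R by rewrite ler_int.
  by rewrite ger0_norm; lra.
have fkR : (f%:~R : R) + 1 <= k%:~R by rewrite -[1]/(1%:~R) -intrD ler_int; lia.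
by rewrite ler0_norm; lra.
Qed.

Lemma irrational_dist_int_gt0 (R : realType) (theta : R) (q : nat) :
  irrational theta -> (0 < q)%N -> 0 < dist_int (q%:R * theta).
Proof.
move=> htheta q0; apply: dist_int_gt0 => k; apply/eqP => h; apply: htheta.
apply/rationalP; exists k, q; rewrite -h mulrC mulKf//.
by rewrite pnatr_eq0 -lt0n.
Qed.

Lemma irrational_dist_int_lbound (R : realType) (theta : R) (Q : nat) :
  irrational theta ->
  exists2 d : R, 0 < d &
    forall q : nat, (0 < q < Q)%N -> d <= dist_int (q%:R * theta).
Proof.
move=> htheta; elim: Q => [|Q [d d0 IH]]; first by exists 1 => // q /andP[].
have [->|Q0] := posnP Q; first by exists 1 => // q; lia.
exists (Num.min d (dist_int (Q%:R * theta))).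
  by rewrite lt_min d0 irrational_dist_int_gt0.
move=> q /andP[q0 qQ]; rewrite ge_min; apply/orP.
by have [->|qQ'] := eqVneq q Q; [right|left; apply: IH; lia].
Qed.

(** The denominators given by Dirichlet's theorem tend to infinity, because the
    distances || q theta || with 0 < q < Q have a positive lower bound. *)
Lemma covering_denominators (R : realType) (theta : R) (Q : nat) :
  irrational theta ->
  exists N0 : nat, forall N : nat, (N0 <= N)%N -> exists q : nat,
    [/\ (0 < q)%N, (Q <= q <= N)%N, dist_int (q%:R * theta) < N%:R^-1 &
      forall x y : R, orbit_dist theta q x y <= 2 / q%:R].
Proof.
move=> htheta; have [d d0 hd] := irrational_dist_int_lbound Q htheta.
exists (Num.truncn d^-1).+1 => N hN; have N0 : (0 < N)%N by exact: leq_trans hN.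
have dN : N%:R^-1 < d.
  rewrite invf_plt ?posrE ?ltr0n//; apply: lt_le_trans (truncnS_gt _) _.
  by rewrite ler_nat.
have [q [p [/andP[q0 qN] cqp h]]] := dirichlet_coprime theta N0.
have hdist : dist_int (q%:R * theta) < N%:R^-1.
  exact: le_lt_trans (dist_int_le _ p) h.
exists q; split=> //.
  rewrite qN andbT leqNgt; apply/negP => qQ.
  by have := hd q; rewrite q0 qQ leNgt (lt_trans hdist dN) => /(_ isT).
have hq : `|q%:R * theta - p%:~R| <= q%:R^-1.
  by apply: le_trans (ltW h) _; rewrite lef_pV2 ?posrE ?ltr0n// ler_nat.
move=> x y; have [j jq] := orbit_covering (x - y) q0 cqp hq.
apply: le_trans; have := orbit_dist_le theta x y jq q0.
by rewrite subr0.
Qed.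

Lemma orbit_dist_le_infinitely_often (R : realType) (theta : R) (N : nat) :
  irrational theta ->
  exists2 n : nat, (N <= n)%N &
    forall x y : R, orbit_dist theta n x y <= 2 * n%:R `^ (- 1).
Proof.
move=> htheta; have [N0 h] := covering_denominators N htheta.
have [q [q0 /andP[Nq _] _ hq]] := h _ (leqnn N0).
by exists q => // x y; rewrite powR_inv1.
Qed.

(** A Diophantine lower bound on || q theta || prevents the Dirichlet
    denominators q <= N from being much smaller than N: c q^(-b) < 1/N. *)
Lemma orbit_dist_le_eventually (R : realType) (theta b c : R) (J : nat) :
  irrational theta -> 0 < b -> 0 < c ->
  (forall q : nat, (J <= q)%N -> c <= q%:R `^ b * dist_int (q%:R * theta)) ->
  exists2 C : R, 0 < C & exists N : nat, forall n : nat, (N <= n)%N ->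
    forall x y : R, orbit_dist theta n x y <= C * n%:R `^ (- b^-1).
Proof.
move=> htheta b0 c0 hJ; have [N0 h] := covering_denominators J htheta.
exists (2 * c `^ (- b^-1)); first by rewrite mulr_gt0 ?powR_gt0.
exists (maxn N0 1) => n; rewrite geq_max => /andP[N0n n0] x y.
have [q [q0 /andP[Jq qn] hdist hq]] := h n N0n.
have nR0 : (0 : R) < n%:R by rewrite ltr0n.
have qR0 : (0 : R) < q%:R by rewrite ltr0n.
apply: le_trans (orbit_dist_anti theta x y q0 qn) _; apply: le_trans (hq x y) _.
rewrite -mulrA ler_pM2l// -powRM ?(ltW c0) ?(ltW nR0)// powRN.
rewrite lef_pV2 ?posrE ?powR_gt0 ?mulr_gt0//.
have cn : c * n%:R <= q%:R `^ b.
  rewrite -ler_pdivlMr//; apply: le_trans (hJ q Jq) _.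
  by rewrite ler_pM2l ?powR_gt0// ltW.
have -> : q%:R = (q%:R `^ b) `^ b^-1 :> R.
  by rewrite -powRrM divff ?gt_eqF// powRr1// ltW.
apply: ge0_ler_powR cn; rewrite ?nnegrE ?powR_ge0//.
  by rewrite invr_ge0 ltW.
by rewrite mulr_ge0// ltW.
Qed.

(** * Measure of a strip around a diagonal of the torus *)

Lemma circleE (R : realType) (x : R) : circle R x = (0 <= x < 1).
Proof. by rewrite /circle /= in_itv. Qed.

Lemma lebesgue_measure_circle (R : realType) : lebesgue_measure (circle R) = 1%E.
Proof. by rewrite lebesgue_measure_itv /= lte_fin ltr01 sube0. Qed.

(** The sets of pairs whose shifted difference is close to an integer.  The type
    mentions [measurableTypeR] so that the sigma-algebra is the one that carries
    the product of the Lebesgue measures. *)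
Definition strip (R : realType) (c r : R) :
    set (measurableTypeR R * measurableTypeR R) :=
  (circle R `*` circle R) `&` [set z | dist_int (z.1 - z.2 + c) < r].

Lemma measurable_strip (R : realType) (c r : R) : measurable (strip c r).
Proof.
apply: measurableI.
  by apply: measurableX; exact: measurable_itv.
have -> : [set z : R * R | dist_int (z.1 - z.2 + c) < r] =
    setT `&` (fun z : R * R => z.1 - z.2 + c) @^-1`
      \bigcup_(k : int) ball (k%:~R : R) r.
  rewrite setTI; apply/seteqP; split=> z /=.
    by move=> /dist_int_ltP[k h]; exists k => //; rewrite /ball /= distrC.
  by move=> [k _]; rewrite /ball /= distrC => h; apply/dist_int_ltP; exists k.
have mg : measurable_fun setT (fun z : R * R => z.1 - z.2 + c).
  apply: measurable_funD; last exact: measurable_cst.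
  by apply: measurable_funB; [exact: measurable_fst|exact: measurable_snd].
apply: mg => //; apply: open_measurable; apply: bigcup_open => k _.
exact: ball_open.
Qed.

(** Up to an integer shift, a lies in [0, 1[; then for r <= 1/2 only the integers
    -1, 0 and 1 can be the one nearest to a - y, so three balls of radius r
    suffice.  For r > 1/2 the bound exceeds the length of the circle. *)
Lemma lebesgue_measure_section_le (R : realType) (a r : R) : 0 < r ->
  (lebesgue_measure (circle R `&` [set y | (dist_int (a - y) < r)%R]) <=
    (6 * r)%:E)%E.
Proof.
move=> r0; set A := circle R `&` _.
have mA : measurable A.
  (* Any abscissa of the circle would do in place of 1/2. *)
  have -> : A = xsection (strip (a - 2^-1) r) 2^-1.
    apply/seteqP; split=> y; rewrite xsectionP /strip /A /=.
      move=> [yc h]; split; first by split => //=; rewrite circleE; lra.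
      by congr (dist_int _ < r): h; lra.
    by move=> [[_ yc] h]; split=> //; congr (dist_int _ < r): h; lra.
  exact: measurable_xsection (measurable_strip _ _).
have [rbig|rsmall] := ltP (2^-1) r.
  apply: (@le_trans _ _ (lebesgue_measure (circle R))).
    by apply: le_measure; rewrite ?inE//; [exact: measurable_itv|exact: subIsetl].
  by rewrite lebesgue_measure_circle lee_fin; lra.
pose a0 := a - (Num.floor a)%:~R.
have a01 : 0 <= a0 < 1.
  by have /andP[] := floor_itv a; rewrite intrD /a0 => h1 h2; lra.
have sub : A `<=` ball (a0 + 1) r `|` ball a0 r `|` ball (a0 - 1) r.
  move=> y [] /=; rewrite circleE => /andP[y0 y1].
  have -> : a - y = a0 - y + (Num.floor a)%:~R by rewrite /a0; ring.
  rewrite dist_intDz => /dist_int_ltP[k]; rewrite ltr_norml => /andP[k1 k2].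
  have km : (-2 < k)%R by rewrite -(ltr_int R); lra.
  have kM : (k < 2)%R by rewrite -(ltr_int R); lra.
  have [kE|[kE|kE]] : k = -1 \/ k = 0 \/ k = 1 by lia.
  - by left; left; rewrite /ball /= ltr_norml; rewrite kE in k1 k2; lra.
  - by left; right; rewrite /ball /= ltr_norml; rewrite kE in k1 k2; lra.
  - by right; rewrite /ball /= ltr_norml; rewrite kE in k1 k2; lra.
have mb (u : R) : measurable (ball u r) by apply: measurable_ball.
apply: le_trans (le_measure lebesgue_measure _ _ sub) _; rewrite ?inE//.
  by apply: measurableU; [apply: measurableU|]; exact: mb.
apply: (le_trans (measureU2 _ _ _)); [|exact: mb|].
  by apply: measurableU; exact: mb.
have mub (u : R) : (lebesgue_measure (ball u r) <= (r *+ 2)%:E)%E.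
  by rewrite (lebesgue_measure_ball _ (ltW r0)).
have -> : 6 * r = r *+ 2 + r *+ 2 + r *+ 2 by ring.
rewrite EFinD; apply: leeD; last exact: mub.
apply: (le_trans (measureU2 _ _ _)); [exact: mb|exact: mb|].
by rewrite EFinD; apply: leeD; exact: mub.
Qed.

(** Fubini: every vertical section of a strip has length at most 6 r. *)
Lemma measure_strip_le (R : realType) (c r : R) : 0 < r ->
  ((@lebesgue_measure R \x @lebesgue_measure R) (strip c r) <= (6 * r)%:E)%E.
Proof.
move=> r0; have mS := measurable_strip c r.
have mc : measurable (circle R) by exact: measurable_itv.
rewrite /product_measure1.
apply: (@le_trans _ _
    (\int[lebesgue_measure]_x ((6 * r)%:E * (\1_(circle R) x)%:E))%E).
  apply: ge0_le_integral => //=.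
  - exact: measurable_fun_xsection.
  - apply: measurable_funeM; apply/measurable_EFinP; exact: measurable_indic.
  - move=> x _; rewrite indicE.
    have [xc|xc] := pselect (circle R x); last first.
      rewrite memNset//= mule0 -(measure0 lebesgue_measure).
      have -> : xsection (strip c r) x = set0; last exact: lexx.
      by apply/seteqP; split => // y; rewrite xsectionP => -[[]].
    rewrite mem_set//= mule1.
    have -> : xsection (strip c r) x =
        circle R `&` [set y | dist_int (x + c - y) < r].
      apply/seteqP; split=> y; rewrite xsectionP /strip /=.
        by move=> [[_ yc] h]; split=> //; congr (dist_int _ < r): h; lra.
      by move=> [yc h]; split=> //; congr (dist_int _ < r): h; lra.
    exact: lebesgue_measure_section_le.
rewrite ge0_integralZl_EFin//=.
- rewrite integral_indic// setIT [X in (_ * X)%E]lebesgue_measure_circle mule1.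
- exact: lexx.
- by apply/measurable_EFinP; exact: measurable_indic.
- by rewrite mulr_ge0// ltW.
Qed.

(** * Lower bounds for the orbit distance, almost everywhere *)

Lemma dist_int_lipschitz (R : realType) (t u : R) :
  dist_int (t + u) <= dist_int t + `|u|.
Proof.
rewrite -lerBlDr; apply: le_dist_int => k; rewrite lerBlDr.
apply: le_trans (dist_int_le _ k) _.
by rewrite addrAC; exact: ler_normD.
Qed.

Lemma powR_natN_le (R : realType) (c e : R) : 0 < c -> 0 < e ->
  exists Q : nat, forall q : nat, (Q <= q)%N -> q%:R `^ (- c) <= e.
Proof.
move=> c0 e0; exists (Num.truncn (e^-1 `^ c^-1)).+1 => q Qq.
have h : e^-1 `^ c^-1 <= q%:R.
  apply: ltW; apply: lt_le_trans (truncnS_gt _) _.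
  by rewrite ler_nat.
rewrite powRN invf_ple ?posrE//; last first.
  by rewrite powR_gt0// (lt_le_trans _ h)// powR_gt0// invr_gt0.
have -> : e^-1 = (e^-1 `^ c^-1) `^ c.
  by rewrite -powRrM mulVf ?gt_eqF// powRr1// invr_ge0 ltW.
by apply: ge0_ler_powR => //; rewrite ?nnegrE ?powR_ge0// ltW.
Qed.

Lemma negligible_small_covers d (T : measurableType d) (R : realType)
    (mu : {measure set T -> \bar R}) (A : set T) :
  (forall e : R, 0 < e ->
    exists B, [/\ measurable B, A `<=` B & (mu B <= e%:E)%E]) ->
  mu.-negligible A.
Proof.
move=> h.
have hpos (i : nat) : (0 : R) < i.+1%:R^-1 by rewrite invr_gt0 ltr0n.
have /choice[B hB] : forall i, exists B,
    [/\ measurable B, A `<=` B & (mu B <= (i.+1%:R^-1)%:E)%E].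
  by move=> i; exact: h.
exists (\bigcap_i B i); split.
- by apply: bigcapT_measurable => i; have [] := hB i.
- apply/eqP; rewrite eq_le measure_ge0 andbT; apply/lee_addgt0Pr => e e0.
  rewrite add0e; have /ltr_add_invr[i] := e0; rewrite add0r => ie.
  have [mB _ Be] := hB i.
  apply: (@le_trans _ _ (mu (B i))).
    apply: le_measure; rewrite ?inE//; last exact: bigcap_inf.
    by apply: bigcapT_measurable => j; have [] := hB j.
  by apply: le_trans Be _; rewrite lee_fin ltW.
- by apply: sub_bigcap => i _; have [] := hB i.
Qed.

Lemma measurable_bigsetU_strip (R : realType) (c : nat -> R) (r : R) (M : nat) :
  measurable (\big[setU/set0]_(m < M) strip (c m) r).
Proof. by apply: bigsetU_measurable => m _; exact: measurable_strip. Qed.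

Lemma mem_bigsetU_strip (R : realType) (c : nat -> R) (r : R) (M m : nat)
    (z : R * R) : (m < M)%N -> strip (c m) r z ->
  (\big[setU/set0]_(m < M) strip (c m) r) z.
Proof.
by move=> mM h; rewrite -(bigcup_mkord M (fun m => strip (c m) r)); exists m.
Qed.

Lemma measure_bigsetU_le d (T : measurableType d) (R : realType)
    (mu : {measure set T -> \bar R}) (F : nat -> set T) (M : nat) (e : R) :
  (forall m, measurable (F m)) -> (forall m, (mu (F m) <= e%:E)%E) ->
  (mu (\big[setU/set0]_(m < M) F m) <= (M%:R * e)%:E)%E.
Proof.
move=> mF hF; apply: (le_trans (Boole_inequality _ (fun i _ => mF i))).
apply: (@le_trans _ _ (\sum_(m < M) e%:E)%E).
  by apply: lee_sum => i _; exact: hF.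
by rewrite sumEFin sumr_const card_ord mulr_natl.
Qed.

Lemma measure_bigsetU_strip_le (R : realType) (c : nat -> R) (r : R) (M : nat) :
  0 < r ->
  ((@lebesgue_measure R \x @lebesgue_measure R)
     (\big[setU/set0]_(m < M) strip (c m) r) <= (M%:R * (6 * r))%:E)%E.
Proof.
move=> r0.
pose P : {measure set (measurableTypeR R * measurableTypeR R) -> \bar R} :=
  (@lebesgue_measure R \x @lebesgue_measure R)%E.
have mS m : measurable (strip (c m) r : set (measurableTypeR R * measurableTypeR R)).
  exact: measurable_strip.
have hS m : (P (strip (c m) r) <= (6 * r)%:E)%E by exact: measure_strip_le.
exact: (@measure_bigsetU_le _ _ _ P (fun m => strip (c m) r) M _ mS hS).
Qed.

(** Borel-Cantelli along n = 2^k, where the measures of m_n < n^(-a) are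
    dominated by a geometric series of ratio 2^(1-a) < 1.  The orbit distance
    decreases with n, so passing from powers of 2 to all n costs only the
    constant 2^(-a). *)
Lemma orbit_dist_ge_eventually (R : realType) (theta a : R) : 1 < a ->
  {ae (@lebesgue_measure R \x @lebesgue_measure R)%E,
    forall z : R * R, (circle R `*` circle R) z ->
      exists N : nat, forall n : nat, (N <= n)%N ->
        2 `^ (- a) * n%:R `^ (- a) <= orbit_dist theta n z.1 z.2}.
Proof.
move=> a1.
pose c (k m : nat) : R := (m%:R - (2 ^ k)%:R) * theta.
pose F (k : nat) := \big[setU/set0]_(m < (2 * 2 ^ k)%N)
  strip (c k m) ((2 ^ k)%:R `^ (- a)).
have mF k : measurable (F k) by exact: (measurable_bigsetU_strip (c k)).
have pow2_gt0 k : (0 : R) < (2 ^ k)%:R by rewrite ltr0n expn_gt0.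
pose w : R := 2 `^ (1 - a).
have w0 : 0 < w by rewrite powR_gt0.
have w1 : w < 1.
  by rewrite -(powRr0 2) /w /powR gt_eqF// ltr_expR ltr_pM2r ?ln_gt0 ?ltr1n//; lra.
have wk k : w ^+ k = (2 ^ k)%:R * (2 ^ k)%:R `^ (- a).
  rewrite -powR_mulrn ?powR_ge0// /w -powRrM mulrC powRrM powR_mulrn// -natrX.
  by rewrite powRD ?powRr1 ?ler0n// (gt_eqF (pow2_gt0 k)) implybT.
have hF k : ((@lebesgue_measure R \x @lebesgue_measure R) (F k) <=
    (geometric 12 w k)%:E)%E.
  apply: (le_trans (measure_bigsetU_strip_le (c k) _ _)).
    by rewrite powR_gt0.
  by rewrite lee_fin /= wk natrM le_eqVlt; apply/orP; left; apply/eqP; ring.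
exists (lim_sup_set F); split.
- apply: bigcapT_measurable => n; by apply: bigcup_measurable => k _; exact: mF.
- apply: lim_sup_set_cvg0 => //.
  apply: (@le_lt_trans _ _ (\sum_(k <oo) (geometric 12 w k)%:E)%E).
    by apply: lee_nneseries => [k _ _|k _]; [exact: measure_ge0|exact: hF].
  apply: (@le_lt_trans _ _ (12 * (1 - w)^-1)%:E); last exact: ltry.
  apply: lime_le.
    by apply: is_cvg_nneseries => k _ _; rewrite lee_fin geometric_ge0// ltW.
  apply: nearW => n; rewrite sumEFin lee_fin.
  by apply: geometric_le_lim => //; rewrite ger0_norm// ltW.
- move=> z /= zbad; apply: contrapT => zlim; apply: zbad => zc.
  move: zlim => /existsNP[K] /not_implyP[_ zK].
  exists (2 ^ K)%N => n Kn.
  have n0 : (0 < n)%N by apply: leq_trans Kn; rewrite expn_gt0.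
  (* The power of 2 with n < 2^k <= 2 n. *)
  pose k := (trunc_log 2 n).+1.
  have nk : (n < 2 ^ k)%N by exact: trunc_log_ltn.
  have kn : (2 ^ k <= 2 * n)%N by rewrite expnS leq_mul2l trunc_logP.
  have Kk : (K <= k)%N.
    by rewrite -(leq_exp2l (m := 2))//; exact: leq_trans Kn (ltnW nk).
  apply: le_trans (orbit_dist_anti theta z.1 z.2 n0 (ltnW nk)).
  apply: (@le_trans _ _ ((2 ^ k)%:R `^ (- a))).
    rewrite -powRM ?ler0n// !powRN lef_pV2 ?posrE ?powR_gt0// ?mulr_gt0 ?ltr0n//.
    apply: ge0_ler_powR; rewrite ?nnegrE ?ler0n//; first by lra.
    by rewrite -natrM ler_nat.
  rewrite leNgt; apply/negP.
  move=> /(orbit_dist_lt_shift (_ : 0 < 2 ^ k)%N)[|m mk hm].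
    by rewrite expn_gt0.
  apply: zK; exists k => //.
  by apply: (mem_bigsetU_strip (c := c k) mk).
Qed.

(** For fixed N, the pairs with m_n < n^(-a) for all n >= N lie in each single
    set m_n < n^(-a); choosing n just above q^g for a very good denominator q
    makes the measure of that set arbitrarily small. *)
Lemma orbit_dist_ge_infinitely_often (R : realType) (theta a b : R) :
  0 < a -> 1 < a * b ->
  (forall J : nat, exists2 q : nat, (J <= q)%N &
    q%:R `^ b * dist_int (q%:R * theta) < 1) ->
  {ae (@lebesgue_measure R \x @lebesgue_measure R)%E,
    forall z : R * R, (circle R `*` circle R) z ->
      forall N : nat, exists2 n : nat, (N <= n)%N &
        n%:R `^ (- a) <= orbit_dist theta n z.1 z.2}.
Proof.
move=> a0 ab hb.
have b0 : 0 < b by rewrite -(pmulr_rgt0 _ a0); apply: lt_trans ab.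
have aV0 : 0 < a^-1 by rewrite invr_gt0.
have aVb : a^-1 < b by rewrite -[a^-1]mul1r ltr_pdivrMr// mulrC.
(* n is taken of order q^g with 1/a < g < b, which makes both q n^(-a) and
   n q^(-b) tend to 0. *)
pose g : R := (a^-1 + b) / 2.
have g0 : 0 < g by rewrite /g; lra.
have gb : 0 < b - g by rewrite /g; lra.
have ag : 0 < a * g - 1.
  have a_neq0 : a != 0 by rewrite gt_eqF.
  by rewrite subr_gt0 -[X in X < _](mulfV a_neq0) ltr_pM2l// /g; lra.
suff null N : ((@lebesgue_measure R \x @lebesgue_measure R)%E).-negligible
    [set z : R * R | (circle R `*` circle R) z /\
      forall n, (N <= n)%N -> orbit_dist theta n z.1 z.2 < n%:R `^ (- a)].
  apply: negligibleS (negligible_bigcup null) => z /= zbad.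
  apply: contrapT => zn; apply: zbad => zc N; apply: contrapT => zN.
  apply: zn; exists N => //; split=> // n Nn; rewrite ltNge; apply/negP => h.
  by apply: zN; exists n.
apply: negligible_small_covers => e e0.
(* The measure is at most 6 (q n^(-a) + n q^(-b)), with terms at most e/24 and
   2 e/24, the factor 2 coming from n <= 2 q^g. *)
have e24 : 0 < e / 24 by rewrite divr_gt0.
have [Q1 hQ1] := powR_natN_le ag e24.
have [Q2 hQ2] := powR_natN_le gb e24.
have N1 : (0 : R) < N.+1%:R^-1 by rewrite invr_gt0 ltr0n.
have [Q3 hQ3] := powR_natN_le g0 N1.
have [q] := hb (maxn 1 (maxn Q1 (maxn Q2 Q3))).
rewrite !geq_max => /and4P[q0 Q1q Q2q Q3q] hq.
have qR0 : (0 : R) < q%:R by rewrite ltr0n.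
have qR_neq0 : q%:R != 0 :> R by rewrite gt_eqF.
have qR1 : (1 : R) <= q%:R by rewrite ler1n.
have [p hp] : exists p : int, `|q%:R * theta - p%:~R| < q%:R `^ (- b).
  apply/dist_int_ltP; rewrite powRN -[_^-1]mul1r ltr_pdivlMr ?powR_gt0//.
  by rewrite mulrC.
pose n := (Num.truncn (q%:R `^ g)).+1.
have qn : q%:R `^ g < n%:R by exact: truncnS_gt.
have qg1 : 1 <= q%:R `^ g by have := ler_powR qR1 (ltW g0); rewrite powRr0.
have n2q : n%:R <= 2 * q%:R `^ g.
  have : (Num.truncn (q%:R `^ g))%:R <= q%:R `^ g by rewrite truncn_le// powR_ge0.
  by rewrite /n -natr1; lra.
have Nn : (N <= n)%N.
  have := hQ3 q Q3q; rewrite powRN lef_pV2 ?posrE ?powR_gt0// => h.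
  have : (N.+1%:R : R) < n%:R by exact: le_lt_trans h qn.
  by rewrite ltr_nat => /ltnW/ltnW.
pose delta := q%:R `^ (- b).
pose r := n%:R `^ (- a) + n%:R / q%:R * delta.
have nR0 : (0 : R) < n%:R by rewrite ltr0n.
have r0 : 0 < r.
  by rewrite addr_gt0 ?powR_gt0// mulr_gt0 ?powR_gt0// divr_gt0.
pose c (m : nat) : R := m%:R / q%:R.
exists (\big[setU/set0]_(m < q) strip (c m) r); split.
- exact: measurable_bigsetU_strip.
- move=> z [zc /(_ n Nn) zn].
  have [//|j jn hj] := orbit_dist_lt_shift _ zn.
  pose i : int := j%:Z - n%:Z.
  have iE : j%:R - n%:R = i%:~R :> R by rewrite /i intrB.
  rewrite iE in hj.
  have hi : `|i%:~R| <= n%:R :> R.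
    by rewrite -intr_norm -[n%:R]/(n%:~R) ler_int /i; move: jn; clear; lia.
  (* m/q is the grid point i p/q modulo 1, close to i theta. *)
  pose m := `|(i * p %% q)%Z|%N.
  have mE : m%:Z = (i * p %% q)%Z by rewrite gez0_abs// modz_ge0// gt_eqF.
  have mq : (m < q)%N by rewrite -ltz_nat mE ltz_pmod.
  apply: (mem_bigsetU_strip (c := c) mq); split=> //=.
  have mR : i%:~R * p%:~R = (i * p %/ q)%Z%:~R * q%:R + m%:R :> R.
    by rewrite -intrM {1}(divz_eq (i * p) q) -mE intrD intrM.
  rewrite -(dist_intDz _ (i * p %/ q)%Z).
  have -> : z.1 - z.2 + c m + (i * p %/ q)%Z%:~R =
      z.1 - z.2 + i%:~R * theta + - (i%:~R / q%:R * (q%:R * theta - p%:~R)).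
    have -> : (i * p %/ q)%Z%:~R = (i%:~R * p%:~R - m%:R) / q%:R :> R.
      by rewrite mR addrK mulfK.
    by rewrite /c; field.
  apply: le_lt_trans (dist_int_lipschitz _ _) _.
  apply: ltr_leD hj _; rewrite normrN normrM normrM normfV.
  rewrite [`|q%:R|]gtr0_norm//; apply: ler_pM => //; last exact: ltW.
  by rewrite ler_pM2r// invr_gt0.
- apply: (le_trans (measure_bigsetU_strip_le c q r0)); rewrite lee_fin.
  have h1 : q%:R * n%:R `^ (- a) <= e / 24.
    apply: le_trans (hQ1 q Q1q).
    have -> : - (a * g - 1) = 1 + g * - a by ring.
    rewrite powRD; last by rewrite (gt_eqF qR0) implybT.
    rewrite powRr1 ?ler0n// ler_pM2l// powRrM !powRN lef_pV2 ?posrE ?powR_gt0//.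
    apply: ge0_ler_powR; rewrite ?nnegrE ?powR_ge0 ?ler0n// ?(ltW a0)//.
    exact: ltW.
  have h2 : n%:R * delta <= 2 * (e / 24).
    apply: le_trans (ler_wpM2r (powR_ge0 _ _) n2q) _.
    rewrite -mulrA ler_pM2l//; apply: le_trans (hQ2 q Q2q).
    rewrite -powRD; last by rewrite (gt_eqF qR0) implybT.
    by rewrite (_ : g + - b = - (b - g))//; ring.
  have -> : q%:R * (6 * r) = 6 * (q%:R * n%:R `^ (- a) + n%:R * delta).
    by rewrite /r; field.
  by lra.
Qed.

(** * Limits inferior and superior *)

Lemma limn_esup_le (R : realType) (u : (\bar R)^nat) (l : \bar R) (N : nat) :
  (forall n, (N <= n)%N -> (u n <= l)%E) -> (limn_esup u <= l)%E.
Proof.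
move=> h; apply: (@le_trans _ _ (ereal_sup (u @` [set n | (N <= n)%N]))).
  by apply: ereal_inf_lbound; exists [set n | (N <= n)%N] => //; exists N.
by apply: ge_ereal_sup => _ [n /= Nn <-]; exact: h.
Qed.

Lemma limn_esup_ge (R : realType) (u : (\bar R)^nat) (l : \bar R) :
  (forall N, exists2 n, (N <= n)%N & (l <= u n)%E) -> (l <= limn_esup u)%E.
Proof.
move=> h; apply: le_ereal_inf_tmp => _ [V [N _ NV] <-].
have [n Nn ln] := h N; apply: le_trans ln _.
by apply: ereal_sup_ubound; exists n => //; exact: NV.
Qed.

Lemma limn_einf_ge (R : realType) (u : (\bar R)^nat) (l : \bar R) (N : nat) :
  (forall n, (N <= n)%N -> (l <= u n)%E) -> (l <= limn_einf u)%E.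
Proof.
move=> h; rewrite leeNr; apply: (limn_esup_le (N := N)) => n Nn.
by rewrite leeN2; exact: h.
Qed.

Lemma limn_einf_le (R : realType) (u : (\bar R)^nat) (l : \bar R) :
  (forall N, exists2 n, (N <= n)%N & (u n <= l)%E) -> (limn_einf u <= l)%E.
Proof.
move=> h; rewrite leeNl; apply: limn_esup_ge => N.
by have [n Nn un] := h N; exists n; rewrite ?leeN2.
Qed.

Lemma limn_einf0_lt (R : realType) (u : R^nat) (e : R) (N : nat) :
  limn_einf (fun n => (u n)%:E) = 0%E -> 0 < e ->
  exists2 n, (N <= n)%N & u n < e.
Proof.
move=> u0 e0; apply: contrapT => h.
suff : (e%:E <= limn_einf (fun n => (u n)%:E))%E by rewrite u0 lee_fin leNgt e0.
apply: (limn_einf_ge (N := N)) => n Nn; rewrite lee_fin leNgt; apply/negP => un.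
by apply: h; exists n.
Qed.

Lemma limn_einf_neq0_lbound (R : realType) (u : R^nat) :
  (forall n, 0 <= u n) -> limn_einf (fun n => (u n)%:E) <> 0%E ->
  exists2 c : R, 0 < c & exists N, forall n, (N <= n)%N -> c <= u n.
Proof.
move=> u0 un0; apply: contrapT => h; apply: un0.
apply/eqP; rewrite eq_le; apply/andP; split; last first.
  by apply: (limn_einf_ge (N := 0)) => n _; rewrite lee_fin.
apply/lee_addgt0Pr => e e0; rewrite add0e; apply: limn_einf_le => N.
apply: contrapT => hN; apply: h; exists e => //; exists N => n Nn.
rewrite leNgt; apply/negP => un; apply: hN; exists n => //.
by rewrite lee_fin ltW.
Qed.

(** * From power bounds on the orbit distance to the logarithmic ratio *)

Lemma ln_div_ln_small (R : realType) (C e : R) : 0 < e ->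
  exists N : nat, forall n : nat, (N <= n)%N -> (1 < n)%N /\ `|ln C / ln n%:R| <= e.
Proof.
move=> e0; exists (Num.truncn (expR (`|ln C| / e))).+2 => n Nn.
have n1 : (1 < n)%N by exact: leq_trans Nn.
split=> //; have lnn : (0 : R) < ln n%:R by rewrite ln_gt0// ltr1n.
rewrite normrM normfV [`|ln n%:R|]gtr0_norm// ler_pdivrMr// mulrC -ler_pdivrMr//.
rewrite -ler_expR lnK ?posrE ?ltr0n ?(ltnW n1)//.
apply: ltW; apply: lt_le_trans (truncnS_gt _) _.
by rewrite ler_nat ltnW.
Qed.

(** When the two orbits meet, the ratio is +oo and the bound is immediate;
    otherwise one takes logarithms. *)
Lemma log_ratio_ge (R : realType) (theta x y a C : R) (n : nat) :
  0 < C -> (1 < n)%N -> orbit_dist theta n x y <= C * n%:R `^ (- a) ->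
  ((a - ln C / ln n%:R)%:E <= log_ratio theta x y n)%E.
Proof.
move=> C0 n1 h; have nR0 : (0 : R) < n%:R by rewrite ltr0n ltnW.
have lnn : (0 : R) < ln n%:R by rewrite ln_gt0// ltr1n.
rewrite /log_ratio inver oppr_eq0 gt_eqF//.
have [m0|m0] := leP (orbit_dist theta n x y) 0.
  rewrite le0_lneNy ?lee_fin//.
  rewrite lt0_mulNye; first by rewrite leey.
  by rewrite lte_fin invr_lt0 oppr_lt0.
rewrite lne_EFin// -EFinM lee_fin invrN mulrN -mulNr ler_pdivlMr//.
rewrite mulrBl divfK ?gt_eqF//.
have : ln (orbit_dist theta n x y) <= ln (C * n%:R `^ (- a)).
  by rewrite ler_ln ?posrE// mulr_gt0 ?powR_gt0.
rewrite lnM ?posrE ?powR_gt0// ln_powR; lra.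
Qed.

Lemma log_ratio_le (R : realType) (theta x y a c : R) (n : nat) :
  0 < c -> (1 < n)%N -> c * n%:R `^ (- a) <= orbit_dist theta n x y ->
  (log_ratio theta x y n <= (a - ln c / ln n%:R)%:E)%E.
Proof.
move=> c0 n1 h; have nR0 : (0 : R) < n%:R by rewrite ltr0n ltnW.
have lnn : (0 : R) < ln n%:R by rewrite ln_gt0// ltr1n.
have cn0 : 0 < c * n%:R `^ (- a) by rewrite mulr_gt0 ?powR_gt0.
have m0 : 0 < orbit_dist theta n x y by exact: lt_le_trans h.
rewrite /log_ratio inver oppr_eq0 gt_eqF//.
rewrite lne_EFin// -EFinM lee_fin invrN mulrN -mulNr ler_pdivrMr//.
rewrite mulrBl divfK ?gt_eqF//.
have : ln (c * n%:R `^ (- a)) <= ln (orbit_dist theta n x y).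
  by rewrite ler_ln ?posrE.
rewrite lnM ?posrE ?powR_gt0// ln_powR; lra.
Qed.

Lemma le_limn_einf_log_ratio (R : realType) (theta x y a C : R) (N : nat) :
  0 < C ->
  (forall n, (N <= n)%N -> orbit_dist theta n x y <= C * n%:R `^ (- a)) ->
  (a%:E <= limn_einf (log_ratio theta x y))%E.
Proof.
move=> C0 h; apply/lee_addgt0Pr => e e0; rewrite -leeBlDr//.
have [M hM] := ln_div_ln_small C e0.
apply: (limn_einf_ge (N := maxn N M)) => n; rewrite geq_max => /andP[Nn Mn].
have [n1 he] := hM n Mn; apply: le_trans (log_ratio_ge C0 n1 (h n Nn)).
by rewrite -EFinB lee_fin lerD2l lerN2; exact: le_trans (ler_norm _) he.
Qed.

Lemma le_limn_esup_log_ratio (R : realType) (theta x y a C : R) : 0 < C ->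
  (forall N : nat, exists2 n, (N <= n)%N &
    orbit_dist theta n x y <= C * n%:R `^ (- a)) ->
  (a%:E <= limn_esup (log_ratio theta x y))%E.
Proof.
move=> C0 h; apply/lee_addgt0Pr => e e0; rewrite -leeBlDr//.
have [M hM] := ln_div_ln_small C e0.
apply: limn_esup_ge => N; have [n] := h (maxn N M).
rewrite geq_max => /andP[Nn Mn] hn; exists n => //.
have [n1 he] := hM n Mn; apply: le_trans (log_ratio_ge C0 n1 hn).
by rewrite -EFinB lee_fin lerD2l lerN2; exact: le_trans (ler_norm _) he.
Qed.

Lemma limn_esup_log_ratio_le (R : realType) (theta x y a c : R) (N : nat) :
  0 < c ->
  (forall n, (N <= n)%N -> c * n%:R `^ (- a) <= orbit_dist theta n x y) ->
  (limn_esup (log_ratio theta x y) <= a%:E)%E.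
Proof.
move=> c0 h; apply/lee_addgt0Pr => e e0.
have [M hM] := ln_div_ln_small c e0.
apply: (limn_esup_le (N := maxn N M)) => n; rewrite geq_max => /andP[Nn Mn].
have [n1 he] := hM n Mn; apply: le_trans (log_ratio_le c0 n1 (h n Nn)) _.
rewrite -EFinD lee_fin lerD2l; apply: le_trans he.
by rewrite -normrN; exact: ler_norm.
Qed.

Lemma limn_einf_log_ratio_le (R : realType) (theta x y a c : R) : 0 < c ->
  (forall N : nat, exists2 n, (N <= n)%N &
    c * n%:R `^ (- a) <= orbit_dist theta n x y) ->
  (limn_einf (log_ratio theta x y) <= a%:E)%E.
Proof.
move=> c0 h; apply/lee_addgt0Pr => e e0.
have [M hM] := ln_div_ln_small c e0.
apply: limn_einf_le => N; have [n] := h (maxn N M).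
rewrite geq_max => /andP[Nn Mn] hn; exists n => //.
have [n1 he] := hM n Mn; apply: le_trans (log_ratio_le c0 n1 hn) _.
rewrite -EFinD lee_fin lerD2l; apply: le_trans he.
by rewrite -normrN; exact: ler_norm.
Qed.

(** * The irrationality exponent and the four bounds *)

(** Working with tau = 1/eta, which is always a real number in [0, 1], avoids
    treating eta = +oo and an empty set of exponents separately afterwards.
    The last clause is limited to a <= 1: for a > 1 and an empty set of
    exponents it would fail. *)
Lemma irrationality_exponentV (R : realType) (theta : R) :
  exists tau : R, [/\ ((irrationality_exponent theta)^-1 = tau%:E)%E, tau <= 1,
    forall b, approx_exponents theta b -> tau <= b^-1 &
    forall a, tau < a -> a <= 1 ->
      exists2 b, approx_exponents theta b & 1 < a * b].
Proof.
set eta := irrationality_exponent theta.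
have ub b : approx_exponents theta b -> (b%:E <= eta)%E.
  move=> hb; rewrite /eta /irrationality_exponent; case: asboolP => [h0|_].
    by rewrite h0 in hb.
  by apply: ereal_sup_ubound; exists b.
have lub t : 1 <= t -> (t%:E < eta)%E -> exists2 b, approx_exponents theta b & t < b.
  move=> t1; rewrite /eta /irrationality_exponent; case: asboolP => [_|_].
    by rewrite lte_fin ltNge t1.
  by move=> /ereal_sup_gt[_ [b hb <-]]; rewrite lte_fin => tb; exists b.
have eta1 : (1 <= eta)%E.
  rewrite /eta /irrationality_exponent; case: asboolP => // /eqP/set0P[b hb].
  apply: (@le_trans _ _ b%:E); first by rewrite lee_fin; case: hb.
  by apply: ereal_sup_ubound; exists b.
have main a : 0 < a -> a <= 1 -> (a^-1%:E < eta)%E ->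
    exists2 b, approx_exponents theta b & 1 < a * b.
  move=> a0 a1 /lub[|b hb ab]; first by rewrite invf_ge1.
  by exists b => //; rewrite -ltr_pdivrMl// mulr1.
case: eta eta1 ub main {lub} => [r| |] // r1 ub main.
- rewrite lee_fin in r1; have r0 : 0 < r by exact: lt_le_trans ltr01 r1.
  exists r^-1; split.
  + by rewrite inver gt_eqF.
  + by rewrite invf_le1.
  + move=> b hb; have b1 : 1 <= b by case: hb.
    rewrite lef_pV2 ?posrE//; first by have := ub b hb; rewrite lee_fin.
    exact: lt_le_trans ltr01 b1.
  + move=> a ra a1; have a0 : 0 < a by apply: lt_trans ra; rewrite invr_gt0.
    by apply: main => //; rewrite lte_fin invf_plt.
- exists 0; split => //.
  + by move=> b [b1 _]; rewrite invr_ge0 (le_trans ler01).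
  + by move=> a a0 a1; apply: main => //; rewrite ltry.
Qed.

(** For 0 < a < 1/eta, the number 1/a is at least 1 but is no exponent of
    approximation, so its liminf is bounded away from 0. *)
Lemma irrationality_exponentV_le_limn_einf (R : realType) (theta x y : R) :
  irrational theta ->
  ((irrationality_exponent theta)^-1 <= limn_einf (log_ratio theta x y))%E.
Proof.
move=> htheta; have [tau [-> tau1 hb _]] := irrationality_exponentV theta.
apply/lee_addgt0Pr => e e0; rewrite -leeBlDr// -EFinB.
have [a0|a0] := leP (tau - e) 0.
  apply: (@le_trans _ _ 0%E); first by rewrite lee_fin.
  apply: (le_limn_einf_log_ratio (C := 1) (N := 1)) => // n n0.
  by rewrite oppr0 powRr0 mulr1 orbit_dist_le1.
have bnot : ~ approx_exponents theta (tau - e)^-1.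
  by move=> /hb; rewrite invrK; lra.
have b1 : 1 <= (tau - e)^-1 by rewrite invf_ge1//; lra.
have [|c c0 [J hJ]] := limn_einf_neq0_lbound
    (u := fun j => j%:R `^ (tau - e)^-1 * dist_int (j%:R * theta)) _
    (fun h => bnot (conj b1 h)).
  by move=> j; rewrite mulr_ge0 ?powR_ge0 ?dist_int_ge0.
have aV0 : 0 < (tau - e)^-1 by rewrite invr_gt0.
have [C C0 [N hN]] := orbit_dist_le_eventually htheta aV0 c0 hJ.
apply: (le_limn_einf_log_ratio C0 (N := N)) => n Nn.
by have := hN n Nn x y; rewrite invrK.
Qed.

Lemma limn_esup_log_ratio_ge1 (R : realType) (theta x y : R) :
  irrational theta -> (1 <= limn_esup (log_ratio theta x y))%E.
Proof.
move=> htheta; apply: (le_limn_esup_log_ratio (C := 2)) => // N.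
by have [n Nn h] := orbit_dist_le_infinitely_often N htheta; exists n.
Qed.

(** The next three lemmas are the filter properties of almost everywhere for the
    product measure, which is written in the statements as a plain set function
    and not as a packaged measure. *)
Lemma ae_plane_imply (R : realType) (P Q : R * R -> Prop) :
  {ae (@lebesgue_measure R \x @lebesgue_measure R)%E, forall z, P z} ->
  (forall z, P z -> Q z) ->
  {ae (@lebesgue_measure R \x @lebesgue_measure R)%E, forall z, Q z}.
Proof. by move=> hP PQ; apply: negligibleS hP => z /= nQ /PQ. Qed.

Lemma ae_plane_foralln (R : realType) (Q : nat -> R * R -> Prop) :
  (forall k, {ae (@lebesgue_measure R \x @lebesgue_measure R)%E, forall z, Q k z}) ->
  {ae (@lebesgue_measure R \x @lebesgue_measure R)%E, forall z, forall k, Q k z}.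
Proof.
pose P : {measure set (measurableTypeR R * measurableTypeR R) -> \bar R} :=
  (@lebesgue_measure R \x @lebesgue_measure R)%E.
exact: (@ae_foralln _ _ _ P Q).
Qed.

Lemma ae_plane_and (R : realType) (P Q : R * R -> Prop) :
  {ae (@lebesgue_measure R \x @lebesgue_measure R)%E, forall z, P z} ->
  {ae (@lebesgue_measure R \x @lebesgue_measure R)%E, forall z, Q z} ->
  {ae (@lebesgue_measure R \x @lebesgue_measure R)%E, forall z, P z /\ Q z}.
Proof.
move=> hP hQ.
have h : forall k : nat, {ae (@lebesgue_measure R \x @lebesgue_measure R)%E,
    forall z, if k is 0%N then P z else Q z} by case.
apply: ae_plane_imply (ae_plane_foralln h) _ => z hz.
by split; [exact: hz 0%N|exact: hz 1%N].
Qed.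

Lemma limn_esup_log_ratio_le1 (R : realType) (theta : R) :
  {ae (@lebesgue_measure R \x @lebesgue_measure R)%E,
    forall z : R * R, (circle R `*` circle R) z ->
      (limn_esup (log_ratio theta z.1 z.2) <= 1)%E}.
Proof.
have a1 (k : nat) : 1 < 1 + k.+1%:R^-1 :> R by rewrite ltrDl invr_gt0 ltr0n.
apply: ae_plane_imply
  (ae_plane_foralln (fun k => orbit_dist_ge_eventually theta (a1 k))) _ => z hz zc.
apply/lee_addgt0Pr => e e0.
have /ltr_add_invr[k] := e0; rewrite add0r => ke.
have [N hN] := hz k zc.
apply: (@le_trans _ _ (1 + k.+1%:R^-1)%:E).
  by apply: (limn_esup_log_ratio_le _ hN); rewrite powR_gt0.
by rewrite -EFinD lee_fin lerD2l ltW.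
Qed.

(** Countably many a decrease to 1/eta.  Those with a <= 1 are reached by some
    exponent b > 1/a; for the others liminf <= limsup <= 1 < a. *)
Lemma limn_einf_log_ratio_le_exponentV (R : realType) (theta : R) :
  {ae (@lebesgue_measure R \x @lebesgue_measure R)%E,
    forall z : R * R, (circle R `*` circle R) z ->
      (limn_einf (log_ratio theta z.1 z.2) <=
        (irrationality_exponent theta)^-1)%E}.
Proof.
have [tau [-> tau1 _ htau]] := irrationality_exponentV theta.
pose a (k : nat) : R := tau + k.+1%:R^-1.
have io k : {ae (@lebesgue_measure R \x @lebesgue_measure R)%E,
    forall z : R * R, (circle R `*` circle R) z -> a k <= 1 ->
      forall N : nat, exists2 n : nat, (N <= n)%N &
        n%:R `^ (- a k) <= orbit_dist theta n z.1 z.2}.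
  have [ak1|ak1] := leP (a k) 1; last by apply: aeW => z _.
  have tauk : tau < a k by rewrite ltrDl invr_gt0 ltr0n.
  have [b [b1 hb] ab] := htau (a k) tauk ak1.
  have a0 : 0 < a k.
    by rewrite -(pmulr_lgt0 _ (lt_le_trans ltr01 b1)); exact: lt_trans ab.
  have := orbit_dist_ge_infinitely_often a0 ab (fun J => limn_einf0_lt J hb ltr01).
  by move=> /ae_plane_imply; apply=> z h zc _; exact: h.
apply: ae_plane_imply
  (ae_plane_and (ae_plane_foralln io) (limn_esup_log_ratio_le1 theta)) _ =>
  z [hz hsup] zc.
apply/lee_addgt0Pr => e e0.
have /ltr_add_invr[k] := e0; rewrite add0r => ke.
apply: (@le_trans _ _ (a k)%:E); last by rewrite -EFinD lee_fin lerD2l ltW.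
have [ak1|ak1] := leP (a k) 1; last first.
  apply: le_trans (limn_einf_sup _) _; apply: le_trans (hsup zc) _.
  by rewrite lee_fin ltW.
apply: (limn_einf_log_ratio_le (c := 1)) => // N.
by have [n Nn h] := hz k zc ak1 N; exists n; rewrite ?mul1r.
Qed.

Theorem theorem10 (R : realType) (theta : R) (htheta : irrational theta) :
  {ae (@lebesgue_measure R \x @lebesgue_measure R)%E,
    forall z : R * R, (circle R `*` circle R) z ->
      limn_einf (log_ratio theta z.1 z.2)
        = ((irrationality_exponent theta)^-1)%E /\
      limn_esup (log_ratio theta z.1 z.2) = 1%E}.
Proof.
apply: ae_plane_imply (ae_plane_and (limn_esup_log_ratio_le1 theta)
  (limn_einf_log_ratio_le_exponentV theta)) _ => z [hsup hinf] zc.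
split; apply/eqP; rewrite eq_le.
- by rewrite (hinf zc); exact: irrationality_exponentV_le_limn_einf.
- by rewrite (hsup zc); exact: limn_esup_log_ratio_ge1.
Qed.
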